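(* Let $G$ be a finite, simple, undirected graph. If $G$ is connected, then there exists a minimum positive semidefinite forcing set $S \subseteq V(G)$ of $G$ such that $G - S$ is connected.
   Context: All graphs are finite, simple and undirected. $G - S$ denotes the subgraph of $G$ induced by $V(G)\setminus S$. The graph with no vertices is regarded as connected (this matters only when $G - S$ is empty, e.g. when $G$ is a single vertex). Positive semidefinite forcing: the vertex set is partitioned as $V(G) = B \cup W$ into blue vertices $B$ and white vertices $W$. A blue vertex $u$ may force a white vertex $v$ to become blue if $v$ is the only neighbor of $u$ in the connected component of the induced subgraph $G[W]$ that contains $v$, where $W$ is the current set of white vertices. At each time step some set of valid forces (with respect to the current coloring) is performed, no white vertex being forced by more than one vertex, and the forced vertices are moved from $W$ to $B$. This is repeated until no further color changes are possible. If all vertices of $G$ are then blue, the initial set $B$ is called a positive semidefinite forcing set of $G$. A minimum positive semidefinite forcing set is one of minimum cardinality among all positive semidefinite forcing sets of $G$. *)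

(* Defs.v *)
From mathcomp Require Import all_boot.

Set Implicit Arguments.
Unset Strict Implicit.
Unset Printing Implicit Defensive.

(* A finite simple undirected graph is a finType T of vertices together with
   a symmetric irreflexive adjacency relation e : rel T. *)

Section PSDForcing.

Variables (T : finType) (e : rel T).
Implicit Types (A B D S : {set T}) (F : {set T * T}) (u v x y : T).

Definition induced A : rel T := [rel x y | [&& x \in A, y \in A & e x y]].

(* The subgraph induced by A is connected; this holds in particular for the
   graph with no vertices, A = set0. *)
Definition connected A : bool :=
  [forall x in A, forall y in A, connect (induced A) x y].

Definition component A v : {set T} :=
  [set x in A | connect (induced A) v x].

(* B is the current set of blue vertices, so that ~: B is the set W of white
   vertices; v is the only neighbour of u in the component of G[W] at v. *)
Definition can_force B u v : bool :=
  [&& u \in B, v \notin B & [set x in component (~: B) v | e u x] == [set v]].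

(* F is a set of forces (u, v), "u forces v", performed simultaneously from the
   colouring B, with no vertex forced by two different vertices. *)
Definition valid_forces B F : bool :=
  [forall p in F, can_force B p.1 p.2] &&
  [forall p in F, forall q in F, (p.2 == q.2) ==> (p.1 == q.1)].

Definition psd_step B D : bool :=
  [exists F, valid_forces B F && (D == B :|: [set p.2 | p in F])].

(* D is the set of blue vertices at the end of some run of the process from S:
   it is reached by finitely many steps and no further force is possible. *)
Definition psd_final S D : bool :=
  connect psd_step S D && [forall u, forall v, ~~ can_force D u v].

Definition psd_forcing_set S : bool := psd_final S [set: T].

Definition min_psd_forcing_set S : Prop :=
  psd_forcing_set S /\
  forall S' : {set T}, psd_forcing_set S' -> #|S| <= #|S'|.

End PSDForcing.

(* Main.v *)
Require Import Defs.
From mathcomp Require Import all_boot.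

(** Call [S] good for a set [K] if [S] is a minimum forcing set avoiding [K], and
    choose a connected [K] of maximum size admitting a good set.  Maximality puts
    every neighbour of [K] in every good set.  If [u] can force [v] from [S], then
    exchanging [u] for [v] yields another forcing set, since [v] can force [u] back.
    Such exchanges show that the vertices outside [K] left white by some good set
    are closed under adjacency outside [K]; were there one, connectedness of the
    graph would produce a neighbour of [K] that is white for some good set.  So
    [K] is the complement of every good set. *)

Set Implicit Arguments.
Unset Strict Implicit.
Unset Printing Implicit Defensive.

(** * Components of induced subgraphs *)

Section Components.

Variables (T : finType) (e : rel T).
Hypothesis e_sym : symmetric e.
Implicit Types (A B K X : {set T}) (u v x y : T).

Lemma component_refl A v : v \in A -> v \in component e A v.
Proof. by move=> vA; rewrite inE vA connect0. Qed.

Lemma component_sub A v : component e A v \subset A.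
Proof. by apply/subsetP => x; rewrite inE => /andP[]. Qed.

Lemma component_closed A v x y :
  x \in component e A v -> y \in A -> e x y -> y \in component e A v.
Proof.
rewrite !inE => /andP[xA vx] yA xy; rewrite yA /=.
by apply: connect_trans vx (connect1 _); apply/and3P.
Qed.

(** The main tool for bounding components from above. Neither [X] nor [v] has to lie in [A]. *)
Lemma component_min A X v : v \in X ->
  (forall x y, x \in X -> y \in A -> e x y -> y \in X) ->
  component e A v \subset X.
Proof.
move=> vX closedX; apply/subsetP => x; rewrite inE => /andP[_ /connectP[p]].
elim: p v vX => [|y p IHp] v vX /=; first by move=> _ ->.
by case/andP=> /and3P[_ yA vy]; apply: IHp; apply: closedX vy.
Qed.

Lemma component_mono A B v : A \subset B -> component e A v \subset component e B v.
Proof.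
move=> /subsetP sAB; apply/subsetP => x; rewrite !inE => /andP[xA vx].
rewrite (sAB _ xA); move: vx; apply: connect_sub => y z /and3P[yA zA yz].
by apply/connect1/and3P; rewrite !sAB.
Qed.

Lemma component_eq A v x :
  x \in component e A v -> component e A x = component e A v.
Proof.
rewrite inE => /andP[_ vx]; apply/setP => y; rewrite !inE.
have sym_ind : connect_sym (induced e A).
  by apply: sym_connect_sym => a b; rewrite /induced /= e_sym andbCA.
by rewrite (same_connect sym_ind vx).
Qed.

Lemma component_id A v : v \in A -> component e (component e A v) v = component e A v.
Proof.
move=> vA; apply/eqP; rewrite eqEsubset component_sub /=.
have vC := component_refl vA; apply: component_min; first exact: component_refl.
move=> x y xD yA xy; have xC := subsetP (component_sub _ v) x xD.
exact: component_closed xD (component_closed xC yA xy) xy.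
Qed.

Lemma connected_component A r : A \subset component e A r -> connected e A.
Proof.
move=> /subsetP sAr; apply/forall_inP => x xA; apply/forall_inP => y yA.
by have := sAr y yA; rewrite -(component_eq (sAr x xA)) inE yA.
Qed.

Lemma connectedE A x y : connected e A -> x \in A -> y \in A -> y \in component e A x.
Proof.
by move=> /forall_inP connA xA yA; rewrite inE yA; exact: (forall_inP (connA x xA)).
Qed.

Lemma connected_setU1 K k u :
  connected e K -> k \in K -> e k u -> connected e (u |: K).
Proof.
move=> connK kK ku; apply: (@connected_component _ k).
have kC : k \in component e (u |: K) k by rewrite component_refl // setU1r.
apply/subsetP => x /setU1P[->|xK]; first exact: component_closed kC (setU11 _ _) ku.
by apply: (subsetP (component_mono k (subsetUr [set u] K))); apply: connectedE.
Qed.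

End Components.

(** * Forcing sets and the exchange of a forcing vertex with the vertex it forces *)

Section Forcing.

Variables (T : finType) (e : rel T).
Hypothesis e_sym : symmetric e.
Implicit Types (B D S : {set T}) (u v x y : T).

Lemma can_forceP B u v :
  reflect [/\ u \in B, v \notin B, e u v &
              forall x, x \in component e (~: B) v -> e u x -> x = v]
          (can_force e B u v).
Proof.
apply: (iffP and3P) => [[uB vB /eqP/setP uE]|[uB vB uv uniq_v]]; split=> //.
- by have := uE v; rewrite in_set1 eqxx inE => /andP[].
- by move=> x xC ux; apply/set1P; rewrite -uE inE xC.
apply/eqP/setP => x; rewrite in_set1 inE; apply/andP/eqP => [[xC]|->].
  exact: uniq_v.
by rewrite component_refl // inE.
Qed.

Lemma can_force_mono B D u v :
  B \subset D -> v \notin D -> can_force e B u v -> can_force e D u v.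
Proof.
move=> sBD vD /can_forceP[uB _ uv uniq_v]; apply/can_forceP; split=> //.
  exact: (subsetP sBD).
move=> x xC; apply: uniq_v; apply: subsetP xC.
by apply: component_mono; rewrite setCS.
Qed.

Lemma psd_step1 B u v : can_force e B u v -> psd_step e B (v |: B).
Proof.
move=> Buv; apply/existsP; exists [set (u, v)].
rewrite imset_set1 setUC eqxx andbT; apply/andP; split.
  by apply/forall_inP => p /set1P ->.
by apply/forall_inP => p /set1P ->; apply/forall_inP => q /set1P ->; rewrite !eqxx.
Qed.

(* The order and simultaneity of the forces are immaterial: only the existence of
   a coloring above [S] that allows no force can stop the process. *)
Lemma psd_forcing_setP S :
  reflect (forall D, S \subset D -> D != [set: T] -> exists u v, can_force e D u v)
          (psd_forcing_set e S).
Proof.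
apply: (iffP andP) => [[/connectP[p]]|forcesS].
  move=> pth fin _ D sSD DnT.
(* If [D] is stuck, no run from [S] leaves [D]: by [can_force_mono], the first force out of [D]
   would still be available at [D]. *)
have [/existsP[u /existsP[v]]|stuck] := boolP [exists u, exists v, can_force e D u v].
  by exists u, v.
  suff TD : [set: T] \subset D by rewrite -subTset TD in DnT.
  rewrite {}fin; elim: p S sSD pth => //= B p IHp S sSD /andP[SB pth].
  apply: IHp pth; case/existsP: SB => F /andP[/andP[/forall_inP forceF _] /eqP ->].
  rewrite subUset sSD; apply/subsetP => _ /imsetP[f fF ->].
  apply/contraT => fD; case/negP: stuck.
  apply/existsP; exists f.1; apply/existsP; exists f.2.
  exact: can_force_mono sSD fD (forceF f fF).
split; last first.
  by apply/forallP => u; apply/forallP => v; apply/negP => /can_forceP[_]; rewrite inE.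
have [n] := ubnP #|~: S|; elim: n S forcesS => // n IHn S forcesS leSn.
have [-> //|SnT] := eqVneq S [set: T].
have [u [v Suv]] := forcesS S (subxx S) SnT.
apply: connect_trans (connect1 (psd_step1 Suv)) _; apply: IHn => [D|].
  by move=> /(subset_trans (subsetUr _ _)); apply: forcesS.
have /can_forceP[_ vS _ _] := Suv.
rewrite ltnS in leSn; apply: leq_trans leSn; apply: proper_card.
by rewrite properC properUr // sub1set.
Qed.

Lemma psd_forcing_setT : psd_forcing_set e [set: T].
Proof. by apply/psd_forcing_setP => D; rewrite subTset => ->. Qed.

(** Color everything outside the component [C] of [x] blue. Some force into [C] is then possible,
    and its source lies in [S], since a white neighbor of a vertex of [C] would belong to [C]. *)
Lemma component_forced S x : psd_forcing_set e S -> x \notin S ->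
  exists u v, v \in component e (~: S) x /\ can_force e S u v.
Proof.
move=> /psd_forcing_setP forcesS xS; set C := component e (~: S) x.
have xC : x \in C by rewrite component_refl // inE.
have sSC : S \subset ~: C by rewrite -setCS setCK component_sub.
have CnT : ~: C != [set: T].
  by apply/eqP => /setP/(_ x); rewrite in_setC in_setT xC.
have [u [v /can_forceP[uC vC uv uniq_v]]] := forcesS _ sSC CnT.
rewrite in_setC negbK in vC; rewrite in_setC in uC; exists u, v; split=> //.
apply/can_forceP; split=> //.
- apply/contraR: uC => uS; apply: component_closed vC _ _; rewrite ?inE //.
  by rewrite e_sym.
- by have := subsetP (component_sub _ _ _) v vC; rewrite inE.
move=> y yC; apply: uniq_v; rewrite setCK.
have vS := subsetP (component_sub _ _ _) v vC.
by rewrite /C -(component_eq e_sym vC) component_id.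
Qed.

Definition exchange S u v := v |: S :\ u.

Lemma card_exchange S u v : u \in S -> v \notin S -> #|exchange S u v| = #|S|.
Proof.
by move=> uS vS; rewrite cardsU1 !inE (negPf vS) andbF (cardsD1 u S) uS.
Qed.

(** A coloring above the exchanged set that contains [u] is also above [S]. In any other, [v] forces
    [u] back, because [v] was the only link from [u] to its component. *)
Lemma psd_forcing_exchange S u v :
  psd_forcing_set e S -> can_force e S u v -> psd_forcing_set e (exchange S u v).
Proof.
move=> /psd_forcing_setP forcesS /can_forceP[uS vS uv uniq_v].
have vu : v != u by apply: contraNneq vS => ->.
apply/psd_forcing_setP => D sSD DnT; have [uD|uD] := boolP (u \in D).
  apply: forcesS DnT; apply/subsetP => x xS; have [-> //|xu] := eqVneq x u.
  by apply: (subsetP sSD); rewrite !inE xu xS orbT.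
exists v, u; apply/can_forceP; split=> //; last 1 first.
(* With [v] blue, white paths from [u] cannot enter the old component of [v], which contains all
   neighbors of [v] that are white for [S]. *)
- pose X := u |: (~: S :\: component e (~: S) v).
  have sCX : component e (~: D) u \subset X.
    apply: component_min; first exact: setU11.
    move=> x y xX yD xy; rewrite !inE in yD *; have [//|yu /=] := eqVneq y u.
    have yS : y \notin S.
      by apply: contra yD => yS; apply: (subsetP sSD); rewrite !inE yu yS orbT.
    have yv : y != v.
      by apply: contraNneq yD => ->; apply: (subsetP sSD); rewrite setU11.
    rewrite yS andbT; apply/negP => /andP[_ vy].
    have yC : y \in component e (~: S) v by rewrite !inE yS.
    move: xX; rewrite in_setU1 => /predU1P[xu|].
      by case/eqP: yv; apply: uniq_v yC _; rewrite -xu.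
    rewrite inE => /andP[/negP xC xS]; apply: xC.
    by apply: component_closed yC xS _; rewrite e_sym.
  move=> x /(subsetP sCX) /setU1P[-> //|/setDP[xS /negP xC]] vx.
  by case: xC; apply: component_closed xS vx; rewrite component_refl // inE.
- by apply: (subsetP sSD); rewrite setU11.
- by rewrite e_sym.
Qed.

(** The newly white [u] had only [v] as a neighbor in this component, and [v] is now blue, so the
    component loses [v] without gaining [u]. This gives the induction measure for [whiten]. *)
Lemma exchange_component S u v x :
  can_force e S u v -> x \in component e (~: S) v -> x != v ->
  component e (~: exchange S u v) x \proper component e (~: S) v.
Proof.
move=> /can_forceP[uS vS uv uniq_v] xC xv.
have vC : v \in component e (~: S) v by rewrite component_refl // inE.
suff sC : component e (~: exchange S u v) x \subset component e (~: S) v :\ v.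
  exact: sub_proper_trans sC (properD1 vC).
apply: component_min => [|y z /setD1P[yv yC]]; first by rewrite in_setD1 xv.
rewrite in_setC in_setU1 negb_or => /andP[zv]; rewrite in_setD1 => zSu yz.
rewrite in_setD1 zv /=.
have [zu|zu] := eqVneq z u.
  by case/eqP: yv; apply: uniq_v => //; rewrite e_sym -zu.
by apply: component_closed yC _ yz; rewrite zu /= in zSu; rewrite inE.
Qed.

End Forcing.

Theorem lemma4 (T : finType) (e : rel T)
    (e_sym : symmetric e) (e_irr : irreflexive e)
    (G_conn : connected e [set: T]) :
  exists S : {set T}, min_psd_forcing_set e S /\ connected e (~: S).
Proof.
have [S0 forceS0 minS0] :
    exists2 S, psd_forcing_set e S & forall S', psd_forcing_set e S' -> #|S| <= #|S'|.
  by case: (arg_minnP (fun S : {set T} => #|S|) (psd_forcing_setT e)) => S; exists S.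
pose good (K S : {set T}) := [&& psd_forcing_set e S, #|S| == #|S0| & K \subset ~: S].
pose P (K : {set T}) := connected e K && [exists S, good K S].
have P0 : P set0.
  apply/andP; split; first by apply/forall_inP => x; rewrite inE.
  by apply/existsP; exists S0; rewrite /good forceS0 eqxx sub0set.
case: (arg_maxnP (fun K : {set T} => #|K|) P0) => K /andP[connK /existsP[S goodS]] maxK.
have nbrK k w S' : good K S' -> k \in K -> w \notin K -> e k w -> w \in S'.
  move=> /and3P[fS' cS' sKS'] kK wK kw; apply: contraT => wS'.
  have /maxK : P (w |: K).
    rewrite /P (connected_setU1 e_sym connK kK kw); apply/existsP; exists S'.
    by rewrite /good fS' cS' subUset sub1set in_setC wS'.
  by rewrite /= cardsU1 wK add1n ltnn.
(* A white path entering [K] from outside would contain a white neighbor of [K], against [nbrK]. *)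
have compK S' x : good K S' -> x \notin S' -> x \notin K ->
    component e (~: S') x \subset ~: K.
  move=> gS' xS' xK; have : component e (~: S') x \subset ~: S' :\: K.
    apply: component_min => [|y z /setDP[yS' yK] zS' yz]; rewrite !inE ?xK //.
    rewrite !inE in yS' zS'; rewrite zS' andbT; apply: contra yS' => zK.
    by apply: nbrK gS' zK yK _; rewrite e_sym.
  by move=> /subset_trans; apply; apply: subsetDr.
pose Z := [set z | z \notin K & [exists S', good K S' && (z \notin S')]].
have goodX S' u v : good K S' -> can_force e S' u v -> v \notin K ->
    good K (exchange S' u v).
  move=> /and3P[fS' /eqP cS' sKS'] uv vK.
  have [uS' vS' _ _] := can_forceP _ _ _ _ uv.
  rewrite /good psd_forcing_exchange // card_exchange // cS' eqxx /=.
  rewrite setCU subsetI setCD (subset_trans sKS' (subsetUl _ _)) andbT.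
  by rewrite subsetC sub1set inE.
(* Some [u] can force some [v] in the white component of [x].  If [q] itself can
   force [v], exchange them; otherwise exchange [u] and [v], which leaves [q] a white
   neighbour in a strictly smaller component. *)
have whiten S' q x : good K S' -> q \notin K -> x \notin K -> x \notin S' -> e q x ->
    q \in Z.
  have [n] := ubnP #|component e (~: S') x|.
  elim: n S' x => // n IHn S' x leCn gS' qK xK xS' qx.
  have [qS'|qS'] := boolP (q \in S'); last first.
    by rewrite inE qK; apply/existsP; exists S'; rewrite gS'.
  have forced v : can_force e S' q v -> v \notin K -> q \in Z.
    move=> qv vK; rewrite inE qK; apply/existsP; exists (exchange S' q v).
    rewrite goodX //= !inE eqxx orbF.
    by have [_ vS' _ _] := can_forceP _ _ _ _ qv; apply: contraNneq vS' => <-.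
  have [fS' _ _] := and3P gS'.
  have [u [v [vC uv]]] := component_forced e_sym fS' xS'.
  have vK : v \notin K by have := subsetP (compK _ _ gS' xS' xK) v vC; rewrite inE.
  have [qu|qu] := eqVneq u q; first by apply: (forced v) => //; rewrite -qu.
  have Cv := component_eq e_sym vC.
  have [/exists_inP[y yC /andP[yv qy]]|noy] :=
    boolP [exists y in component e (~: S') v, (y != v) && e q y].
    have prC := exchange_component e_sym uv yC yv.
    have yS' : y \in ~: S' := subsetP (component_sub _ _ _) y yC.
    rewrite inE in yS'; have yK : y \notin K.
      by have := subsetP (compK _ _ gS' xS' xK) y; rewrite -Cv in_setC; apply.
    apply: (IHn (exchange S' u v) y) => //; last first.
    - by rewrite !inE (negPf yv) (negPf yS') andbF.
    - exact: goodX.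
    - by apply: leq_trans (proper_card prC) _; rewrite Cv -ltnS.
  (* In the remaining case [x], being a neighbor of [q] in this component, must be [v] itself. *)
  have uniq_v y : y \in component e (~: S') v -> e q y -> y = v.
    move=> yC qy; apply/eqP/contraT => yv.
    by case/exists_inP: noy; exists y; rewrite ?yv.
  have [_ vS' _ _] := can_forceP _ _ _ _ uv.
  apply: (forced v) => //; apply/can_forceP; split=> //.
  by rewrite -(uniq_v x) // Cv component_refl // inE.
have Z0 z : z \notin Z.
  apply/negP => zZ; have := zZ; rewrite inE => /andP[zK /existsP[S' /andP[gS' zS']]].
  (* An empty [K] would be beaten in size by the singleton of [z]. *)
  have [K0|[k kK]] := set_0Vmem K.
    have /maxK : P [set z].
      apply/andP; split.
        apply/(@connected_component _ _ e_sym _ z)/subsetP => _ /set1P ->.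
        by rewrite component_refl // set11.
      apply/existsP; exists S'; have [fS' cS' _] := and3P gS'.
      by rewrite /good fS' cS' sub1set in_setC.
    by rewrite /= K0 cards1 cards0.
  (* A neighbor of a vertex of [Z] is outside [K] by [nbrK], hence in [Z] by [whiten]. So [Z] would
     spread over the whole graph and reach [k]. *)
  have sZ : component e [set: T] z \subset Z.
    apply: component_min zZ _ => x y.
    rewrite inE => /andP[xK /existsP[S1 /andP[gS1 xS1]]] _ xy.
    apply: (whiten S1 y x) => //; rewrite 1?e_sym //.
    by apply: contra xS1 => yK; apply: nbrK gS1 yK xK _; rewrite e_sym.
  by have := subsetP sZ k (connectedE G_conn (in_setT z) (in_setT k)); rewrite inE kK.
have [fS /eqP cS sKS] := and3P goodS.
exists S; split; first by split=> // S' /minS0; rewrite cS.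
suff -> : ~: S = K by [].
apply/setP => z; rewrite inE; apply/idP/idP => [zS|zK].
  apply: contraT => zK; have := Z0 z; rewrite inE zK.
  by case/existsP; exists S; rewrite goodS.
by have := subsetP sKS z zK; rewrite inE.
Qed.
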